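(* Let $X$ be a real random variable with distribution function $F$ on $\mathbb{R}$ such that all moments of $X$ are finite, i.e. $E|X|^n<\infty$ for every integer $n\ge 1$. Let $a>0$. Then the function $$s\mapsto h_X(s,a)=E\big[(a+iX)^{-s}\big]=\int_{-\infty}^{\infty}\frac{1}{(a+ix)^s}\,dF(x)$$ is an analytic function of $s\in\mathbb{C}$.
   Context: The function $h_X(s,a)=E[(a+iX)^{-s}]$ is called the Hurwitz Zeta function induced by the random variable $X$. Complex powers are taken with the principal branch: $a+ix=\sqrt{a^2+x^2}\,e^{i\theta}$ with $\theta=\tan^{-1}(x/a)\in(-\pi/2,\pi/2)$, and $(a+ix)^{-s}=(a^2+x^2)^{-s/2}e^{-i\theta s}$. *)

(* Defs.v *)
From HB Require Import structures.
From mathcomp Require Import all_boot all_order all_algebra.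
From mathcomp Require Import all_classical all_reals all_analysis.
From mathcomp Require Import complex.

Set Implicit Arguments.
Unset Strict Implicit.
Unset Printing Implicit Defensive.

Import Order.TTheory GRing.Theory Num.Theory.
Import numFieldNormedType.Exports.

Local Open Scope classical_set_scope.
Local Open Scope ring_scope.
Local Open Scope complex_scope.

Definition cexp (R : realType) (z : R[i]) : R[i] :=
  (expR (complex.Re z))%:C * (cos (complex.Im z) +i* sin (complex.Im z)).

(* r^w = e^(w ln r); meaningful for r > 0 only. *)
Definition rcpow (R : realType) (r : R) (w : R[i]) : R[i] :=
  cexp (w * (ln r)%:C).

(* The principal power z^w = (x^2 + y^2)^(w/2) e^(i theta w) of z = x + iy in
   the right half-plane x > 0, where theta = atan (y / x) in (-pi/2, pi/2); the
   formula is not the principal branch when x <= 0. *)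
Definition cpow (R : realType) (z w : R[i]) : R[i] :=
  rcpow (complex.Re z ^+ 2 + complex.Im z ^+ 2) (w / 2) *
  cexp ('i%C * (atan (complex.Im z / complex.Re z))%:C * w).

Definition cintegrable d (T : measurableType d) (R : realType)
    (mu : {measure set T -> \bar R}) (f : T -> R[i]) : Prop :=
  mu.-integrable setT (fun t => (complex.Re (f t))%:E) /\
  mu.-integrable setT (fun t => (complex.Im (f t))%:E).

(* A junk value unless cintegrable mu f. *)
Definition cintegral d (T : measurableType d) (R : realType)
    (mu : {measure set T -> \bar R}) (f : T -> R[i]) : R[i] :=
  (\int[mu]_t complex.Re (f t)) +i* (\int[mu]_t complex.Im (f t)).

Definition hurwitz_zeta d (T : measurableType d) (R : realType)
    (P : probability T R) (X : {RV P >-> R}) (s : R[i]) (a : R) : R[i] :=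
  cintegral P (fun t => cpow (a +i* X t) (- s)).

(* The library's cdf is valued in \bar R, but lebesgue_stieltjes_measure takes a
   cumulative function valued in R. *)
Definition dist_fun d (T : measurableType d) (R : realType)
    (P : probability T R) (X : {RV P >-> R}) (r : R) : R := fine (cdf X r).

Section dist_fun_cumulative.
Context d (T : measurableType d) (R : realType) (P : probability T R).
Variable X : {RV P >-> R}.

Lemma dist_fun_nondecreasing : nondecreasing (dist_fun X).
Proof.
by move=> *; rewrite fine_le ?fin_num_measure// cdf_nondecreasing.
Qed.

Lemma dist_fun_right_continuous : right_continuous (dist_fun X).
Proof.
move=> r; apply: fine_cvg.
by rewrite fineK ?fin_num_measure//; exact: cdf_right_continuous.
Qed.

HB.instance Definition _ := isCumulative.Build R _ R (dist_fun X)
  dist_fun_nondecreasing dist_fun_right_continuous.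

End dist_fun_cumulative.

(* Over K = R[i], 0 < r says that r is real and positive. *)
Definition analytic_at (K : numFieldType) (f : K -> K) (z0 : K) : Prop :=
  exists (r : K) (c : nat -> K), 0 < r /\
    forall z, `|z - z0| < r ->
      [series c n * (z - z0) ^+ n]_n @ \oo --> f z.

Definition entire (K : numFieldType) (f : K -> K) : Prop :=
  forall z, analytic_at f z.

(* Main.v *)
Require Import Defs.
From mathcomp Require Import all_boot all_order all_algebra.
From mathcomp Require Import all_classical all_reals all_analysis.
From mathcomp Require Import complex.
From mathcomp Require Import measurable_realfun ring lra.

Set Implicit Arguments.
Unset Strict Implicit.
Unset Printing Implicit Defensive.

Import Order.TTheory GRing.Theory Num.Theory.
Import numFieldNormedType.Exports.
Import ComplexField.Normc.

Local Open Scope classical_set_scope.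
Local Open Scope ring_scope.
Local Open Scope complex_scope.

(** Write [L x = ln (a^2 + x^2) / 2 + i atan (x / a)] for the principal
    logarithm of [a + ix]; then [(a + ix)^(- s) = exp (- s L x)], so that the
    Hurwitz zeta function is the Laplace transform of the complex random
    variable [L X], and the claim has two halves.

    The first half is general ([laplace_transform_entire]): if a complex
    function [Z] has all its exponential moments [E exp (m |Z|)] finite, then
    [s |-> E exp (s Z)] is entire.  Around [s0] the coefficients of the series
    are [E (exp (s0 Z) Z^k / k!)].  For [q = |s - s0| < 1] the Taylor remainder
    of [exp ((s - s0) Z)] at order [n] is at most [2 q^n exp (4 |Z|)]
    ([cexp_remainder_scaled]): the factor [q^n] leaves the expectation, the rest
    is an exponential moment, and the error of the partial sums decays
    geometrically.  No passage to the limit under the integral is involved.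
    The remainder bound itself ([cexp_remainder]) comes from the mean value
    theorem applied to [t |-> exp (- t z) E_n (t z)], with [E_n] the Taylor
    polynomial, because all but one term of its derivative cancel.

    The second half bounds the exponential moments of [L X]
    ([expR_half_plane_log_le]): as [L] grows only logarithmically,
    [exp (m |L x|)] is at most a polynomial in [|x|], whose expectation is
    finite because [X] has moments of all orders.

    The formula as an integral against the distribution function is a change of
    variables, the Lebesgue-Stieltjes measure of the distribution function being
    the law of [X] ([lebesgue_stieltjes_dist_fun], [integral_dist_fun]). *)

(** * Complex numbers and the complex exponential *)

Lemma ReD (R : rcfType) (z w : R[i]) :
  complex.Re (z + w) = complex.Re z + complex.Re w.
Proof. by case: z; case: w. Qed.

Lemma ImD (R : rcfType) (z w : R[i]) :
  complex.Im (z + w) = complex.Im z + complex.Im w.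
Proof. by case: z; case: w. Qed.

Lemma ReM (R : rcfType) (z w : R[i]) :
  complex.Re (z * w) =
  complex.Re z * complex.Re w - complex.Im z * complex.Im w.
Proof. by case: z; case: w. Qed.

Lemma ImM (R : rcfType) (z w : R[i]) :
  complex.Im (z * w) =
  complex.Re z * complex.Im w + complex.Im z * complex.Re w.
Proof. by case: z; case: w. Qed.

Lemma norm_normc (R : rcfType) (z : R[i]) : `|z| = (normc z)%:C.
Proof. by []. Qed.

Lemma normc_ge0 (R : rcfType) (z : R[i]) : 0 <= normc z.
Proof. by case: z => x y; exact: sqrtr_ge0. Qed.

Lemma normcX (R : rcfType) (z : R[i]) n : normc (z ^+ n) = normc z ^+ n.
Proof. by elim: n => [|n ih]; rewrite ?normc1// !exprS normcM ih. Qed.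

Lemma normc_real (R : rcfType) (x : R) : normc x%:C = `|x|.
Proof. by rewrite /= expr0n addr0 sqrtr_sqr. Qed.

Lemma normr_Re_le_normc (R : rcfType) (z : R[i]) : `|complex.Re z| <= normc z.
Proof. by case: z => x y /=; rewrite -sqrtr_sqr ler_wsqrtr// lerDl sqr_ge0. Qed.

Lemma normr_Im_le_normc (R : rcfType) (z : R[i]) : `|complex.Im z| <= normc z.
Proof. by case: z => x y /=; rewrite -sqrtr_sqr ler_wsqrtr// lerDr sqr_ge0. Qed.

Lemma normc_le_ReIm (R : rcfType) (z : R[i]) :
  normc z <= `|complex.Re z| + `|complex.Im z|.
Proof.
case: z => x y /=; rewrite -[leRHS]ger0_norm ?addr_ge0// -[leRHS]sqrtr_sqr.
rewrite ler_wsqrtr// sqrrD !real_normK ?num_real//.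
by rewrite -addrA lerD2l lerDr mulrn_wge0// mulr_ge0.
Qed.

Lemma cexpD (R : realType) (z w : R[i]) : cexp (z + w) = cexp z * cexp w.
Proof.
rewrite /cexp !ReD !ImD expRD cosD sinD.
by apply/eqP; rewrite eq_complex/=; apply/andP; split; apply/eqP; ring.
Qed.

Lemma cexp0 (R : realType) : cexp (0 : R[i]) = 1.
Proof. by rewrite /cexp /= expR0 cos0 sin0 mul1r. Qed.

Lemma normc_cexp (R : realType) (z : R[i]) :
  normc (cexp z) = expR (complex.Re z).
Proof.
rewrite /cexp normcM normc_real ger0_norm ?expR_ge0//=.
by rewrite cos2Dsin2 sqrtr1 mulr1.
Qed.

Lemma normc_cexp_le (R : realType) (z : R[i]) :
  normc (cexp z) <= expR (normc z).
Proof.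
by rewrite normc_cexp ler_expR (le_trans (ler_norm _))// normr_Re_le_normc.
Qed.

(** * Derivatives of complex functions of a real variable *)

Definition is_cderive (R : realType) (f : R -> R[i]) (t : R) (l : R[i]) :=
  is_derive t 1 (fun u => complex.Re (f u)) (complex.Re l) /\
  is_derive t 1 (fun u => complex.Im (f u)) (complex.Im l).

Lemma is_cderive_cst (R : realType) (c : R[i]) (t : R) :
  is_cderive (fun=> c) t 0.
Proof. by split; exact: is_derive_cst. Qed.

Lemma is_cderiveD (R : realType) (f g : R -> R[i]) (t : R) (df dg : R[i]) :
  is_cderive f t df -> is_cderive g t dg ->
  is_cderive (fun u => f u + g u) t (df + dg).
Proof.
move=> [rf mf] [rg mg]; split.
  rewrite ReD (_ : (fun _ => _) = (fun u => complex.Re (f u)) +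
    (fun u => complex.Re (g u))); first exact: is_deriveD.
  by apply/funext => u; rewrite ReD.
rewrite ImD (_ : (fun _ => _) = (fun u => complex.Im (f u)) +
  (fun u => complex.Im (g u))); first exact: is_deriveD.
by apply/funext => u; rewrite ImD.
Qed.

Lemma is_cderiveM (R : realType) (f g : R -> R[i]) (t : R) (df dg : R[i]) :
  is_cderive f t df -> is_cderive g t dg ->
  is_cderive (fun u => f u * g u) t (df * g t + f t * dg).
Proof.
move=> [rf mf] [rg mg]; split.
  rewrite (_ : (fun _ => _) =
    (fun u => complex.Re (f u)) * (fun u => complex.Re (g u)) -
    (fun u => complex.Im (f u)) * (fun u => complex.Im (g u))).
    apply: is_derive_eq; rewrite ReD !ReM /GRing.scale/=; ring.
  by apply/funext => u; rewrite ReM.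
rewrite (_ : (fun _ => _) =
  (fun u => complex.Re (f u)) * (fun u => complex.Im (g u)) +
  (fun u => complex.Im (f u)) * (fun u => complex.Re (g u))).
  apply: is_derive_eq; rewrite ImD !ImM /GRing.scale/=; ring.
by apply/funext => u; rewrite ImM.
Qed.

Lemma is_cderive_real (R : realType) (f : R -> R) (t df : R) :
  is_derive t 1 f df -> is_cderive (fun u => (f u)%:C) t df%:C.
Proof. by move=> Df; split => //=; exact: is_derive_cst. Qed.

Lemma is_cderive_cexp (R : realType) (z : R[i]) (t : R) :
  is_cderive (fun u => cexp (u%:C * z)) t (z * cexp (t%:C * z)).
Proof.
have linE (x u : R) : is_derive u 1 (fun u => u * x) x.
  rewrite (_ : (fun _ => _) = id * cst x)//.
  by apply: is_derive_eq; rewrite /GRing.scale/= mulr0 add0r mulr1.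
case: z => x y.
have De : is_derive t 1 (fun u : R => expR (u * x)) (expR (t * x) * x).
  exact: (@is_derive1_comp _ expR (fun u => u * x)).
have Dc : is_derive t 1 (fun u : R => cos (u * y)) (- sin (t * y) * y).
  exact: (@is_derive1_comp _ cos (fun u => u * y)).
have Ds : is_derive t 1 (fun u : R => sin (u * y)) (cos (t * y) * y).
  exact: (@is_derive1_comp _ sin (fun u => u * y)).
have -> : (fun u : R => cexp (u%:C * (x +i* y))) =
    (fun u : R => (expR (u * x))%:C * ((cos (u * y)) +i* (sin (u * y)))).
  by apply/funext => u; rewrite /cexp ReM ImM /= !(mul0r, subr0, addr0).
have -> : (x +i* y) * cexp (t%:C * (x +i* y)) =
    (expR (t * x) * x)%:C * ((cos (t * y)) +i* (sin (t * y))) +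
    (expR (t * x))%:C * ((- sin (t * y) * y) +i* (cos (t * y) * y)).
  rewrite /cexp ReM ImM /= !(mul0r, subr0, addr0).
  by apply/eqP; rewrite eq_complex/=; apply/andP; split; apply/eqP; ring.
by apply: is_cderiveM; [exact: is_cderive_real|split].
Qed.

(** The real mean value theorem gives different intermediate points for the real
    and the imaginary part, whence the factor [2]. *)
Lemma cmean_value_le (R : realType) (f df : R -> R[i]) (M : R) :
  (forall t, is_cderive f t (df t)) ->
  (forall t, 0 <= t <= 1 -> normc (df t) <= M) ->
  normc (f 1 - f 0) <= 2 * M.
Proof.
move=> Df dfM.
have mvt (g dg : R -> R) : (forall t : R, is_derive t 1 g (dg t)) ->
    (forall t, 0 <= t <= 1 -> `|dg t| <= M) -> `|g 1 - g 0| <= M.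
  move=> Dg dgM; have gC : {within `[0, 1], continuous g}.
    by apply: derivable_within_continuous => t _; exact: ex_derive.
  have [c c01 ->] := MVT_segment ler01 (fun t _ => Dg t) gC.
  by rewrite subr0 mulr1 dgM.
rewrite (le_trans (normc_le_ReIm _))// mulr_natl mulr2n; apply: lerD.
  rewrite ReD (_ : complex.Re (- f 0) = - complex.Re (f 0)); last first.
    by case: (f 0).
  apply: (mvt (fun t => complex.Re (f t)) (fun t => complex.Re (df t))) => t.
    by have [] := Df t.
  by move=> /dfM; apply: le_trans; exact: normr_Re_le_normc.
rewrite ImD (_ : complex.Im (- f 0) = - complex.Im (f 0)); last by case: (f 0).
apply: (mvt (fun t => complex.Im (f t)) (fun t => complex.Im (df t))) => t.
  by have [] := Df t.
by move=> /dfM; apply: le_trans; exact: normr_Im_le_normc.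
Qed.

(** * Taylor remainder of the complex exponential *)

Definition cexp_sum (R : realType) (n : nat) (z : R[i]) : R[i] :=
  \sum_(k < n) z ^+ k / k`!%:R.

(** As [E_n.+1' = E_n] for the Taylor polynomials [E_n] of the exponential, the
    chain rule only brings out the factor [z]. *)
Lemma is_cderive_cexp_sum (R : realType) n (z : R[i]) (t : R) :
  is_cderive (fun u => cexp_sum n.+1 (u%:C * z)) t (z * cexp_sum n (t%:C * z)).
Proof.
elim: n => [|n ih].
  have -> : (fun u : R => cexp_sum 1 (u%:C * z)) = fun=> 1.
    by apply/funext => u; rewrite /cexp_sum big_ord1 expr0 fact0 divr1.
  by rewrite /cexp_sum big_ord0 mulr0; exact: is_cderive_cst.
rewrite /cexp_sum [X in _ * X]big_ord_recr/= mulrDr.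
have -> : (fun u : R => \sum_(k < n.+2) (u%:C * z) ^+ k / k`!%:R) =
    (fun u : R => cexp_sum n.+1 (u%:C * z) +
      (u ^+ n.+1)%:C * (z ^+ n.+1 / n.+1`!%:R)).
  by apply/funext => u; rewrite big_ord_recr/= exprMn rmorphXn mulrA.
apply: is_cderiveD => //.
have -> : z * ((t%:C * z) ^+ n / n`!%:R) =
   (n.+1%:R * t ^+ n)%:C * (z ^+ n.+1 / n.+1`!%:R) + (t ^+ n.+1)%:C * 0.
  rewrite mulr0 addr0 factS natrM invfM rmorphM rmorphXn/= rmorph_nat.
  rewrite exprMn exprS.
  have : (n.+1%:R : R[i]) != 0 by rewrite pnatr_eq0.
  have : (n`!%:R : R[i]) != 0 by rewrite pnatr_eq0 -lt0n fact_gt0.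
  by move=> ? ?; field; apply/andP.
apply: is_cderiveM; last exact: is_cderive_cst.
apply: is_cderive_real.
rewrite (_ : (fun u : R => _) = id ^+ n.+1); last first.
  by apply/funext => u; rewrite exprfctE.
by apply: is_derive_eq; rewrite /GRing.scale/= mulr1.
Qed.

(** The derivative of [phi t = exp (- t z) E_n.+1 (t z)] reduces to the single
    term [- z exp (- t z) (t z)^n / n!], and
    [exp z - E_n.+1 z = - exp z (phi 1 - phi 0)]. *)
Lemma cexp_remainder (R : realType) n (z : R[i]) :
  normc (cexp z - cexp_sum n.+1 z) <=
  2 * (expR (2 * normc z) * (normc z ^+ n.+1 / n`!%:R)).
Proof.
pose phi (t : R) := cexp (t%:C * - z) * cexp_sum n.+1 (t%:C * z).
pose dphi (t : R) := - z * cexp (t%:C * - z) * ((t%:C * z) ^+ n / n`!%:R).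
have Dphi t : is_cderive phi t (dphi t).
  have -> : dphi t = - z * cexp (t%:C * - z) * cexp_sum n.+1 (t%:C * z) +
      cexp (t%:C * - z) * (z * cexp_sum n (t%:C * z)).
    rewrite /dphi {1}/cexp_sum big_ord_recr/= -/(cexp_sum n _); ring.
  by apply: is_cderiveM; [exact: is_cderive_cexp|exact: is_cderive_cexp_sum].
have dphiM t : 0 <= t <= 1 ->
    normc (dphi t) <= expR (normc z) * (normc z ^+ n.+1 / n`!%:R).
  move=> /andP[t0 t1]; rewrite /dphi.
  have eM : normc (cexp (t%:C * - z)) <= expR (normc z).
    rewrite (le_trans (normc_cexp_le _))// ler_expR normcM normc_real.
    by rewrite ger0_norm// normcN ler_piMl// normc_ge0.
  move: (cexp (t%:C * - z)) eM => e eM.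
  rewrite !normcM normcV normcX normcM normcN normc_real ger0_norm//.
  have -> : normc (n`!%:R : R[i]) = n`!%:R.
    by rewrite -(rmorph_nat (real_complex R)) normc_real ger0_norm.
  have -> : normc z * normc e * ((t * normc z) ^+ n / n`!%:R) =
      t ^+ n * normc e * (normc z ^+ n.+1 / n`!%:R).
    by rewrite exprMn exprS; ring.
  rewrite ler_wpM2r ?divr_ge0 ?exprn_ge0 ?normc_ge0//.
  by rewrite -[leRHS]mul1r ler_pM ?exprn_ge0 ?normc_ge0 ?exprn_ile1.
have phi10 : phi 1 - phi 0 = cexp (- z) * cexp_sum n.+1 z - 1.
  rewrite /phi !(mul1r, mul0r) cexp0 mul1r; congr (_ - _).
  rewrite /cexp_sum big_ord_recl/= expr0 fact0 divr1 big1 ?addr0// => i _.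
  by rewrite expr0n mul0r.
have -> : cexp z - cexp_sum n.+1 z = - (cexp z * (phi 1 - phi 0)).
  by rewrite phi10 mulrBr mulrA -cexpD subrr cexp0 mul1r mulr1 opprB.
rewrite normcN normcM.
have := cmean_value_le Dphi dphiM.
move=> /(ler_pM (normc_ge0 _) (normc_ge0 _) (normc_cexp_le z)) /le_trans; apply.
rewrite [2 * normc z]mulr_natl mulr2n expRD.
by rewrite mulrCA -!mulrA.
Qed.

(** * Measurability of complex functions *)

Definition cmeasurable_fun d (T : measurableType d) (R : realType)
    (f : T -> R[i]) : Prop :=
  measurable_fun setT (fun t => complex.Re (f t)) /\
  measurable_fun setT (fun t => complex.Im (f t)).

Lemma cmeasurable_cst d (T : measurableType d) (R : realType) (c : R[i]) :
  cmeasurable_fun (fun _ : T => c).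
Proof. by split; exact: measurable_cst. Qed.

Lemma cmeasurable_funB d (T : measurableType d) (R : realType)
    (f g : T -> R[i]) :
  cmeasurable_fun f -> cmeasurable_fun g ->
  cmeasurable_fun (fun t => f t - g t).
Proof.
move=> [rf mf] [rg mg]; split.
  rewrite (_ : (fun _ => _) =
    (fun t => complex.Re (f t)) \- (fun t => complex.Re (g t))).
    exact: measurable_funB.
  by apply/funext => t /=; case: (f t); case: (g t).
rewrite (_ : (fun _ => _) =
  (fun t => complex.Im (f t)) \- (fun t => complex.Im (g t))).
  exact: measurable_funB.
by apply/funext => t /=; case: (f t); case: (g t).
Qed.

Lemma cmeasurable_funM d (T : measurableType d) (R : realType)
    (f g : T -> R[i]) :
  cmeasurable_fun f -> cmeasurable_fun g ->
  cmeasurable_fun (fun t => f t * g t).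
Proof.
move=> [rf mf] [rg mg]; split.
  under eq_fun do rewrite ReM.
  by apply: measurable_funB; exact: measurable_funM.
under eq_fun do rewrite ImM.
by apply: measurable_funD; exact: measurable_funM.
Qed.

Lemma cmeasurable_funX d (T : measurableType d) (R : realType)
    (f : T -> R[i]) n :
  cmeasurable_fun f -> cmeasurable_fun (fun t => f t ^+ n).
Proof.
move=> mf; elim: n => [|n ih]; first exact: cmeasurable_cst.
by under eq_fun do rewrite exprS; exact: cmeasurable_funM.
Qed.

Lemma cmeasurable_cexp d (T : measurableType d) (R : realType)
    (f : T -> R[i]) :
  cmeasurable_fun f -> cmeasurable_fun (fun t => cexp (f t)).
Proof.
move=> [rf mf].
have me : measurable_fun setT (fun t => expR (complex.Re (f t))).
  by apply: measurableT_comp => //; exact: measurable_expR.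
split.
  under eq_fun do rewrite ReM /= mul0r subr0.
  apply: measurable_funM => //; apply: measurableT_comp mf.
  by apply: continuous_measurable_fun; exact: continuous_cos.
under eq_fun do rewrite ImM /= mul0r addr0.
apply: measurable_funM => //; apply: measurableT_comp mf.
by apply: continuous_measurable_fun; exact: continuous_sin.
Qed.

Lemma cmeasurable_comp d d' (T : measurableType d) (T' : measurableType d')
    (R : realType) (f : T' -> R[i]) (X : T -> T') :
  cmeasurable_fun f -> measurable_fun setT X ->
  cmeasurable_fun (fun t => f (X t)).
Proof.
by move=> [rf mf] mX; split; [exact: (measurableT_comp rf)|
  exact: (measurableT_comp mf)].
Qed.

Lemma measurable_normc d (T : measurableType d) (R : realType)
    (f : T -> R[i]) :
  cmeasurable_fun f -> measurable_fun setT (fun t => normc (f t)).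
Proof.
move=> [rf mf].
have -> : (fun t => normc (f t)) =
    (fun t => Num.sqrt (complex.Re (f t) ^+ 2 + complex.Im (f t) ^+ 2)).
  by apply/funext => t; case: (f t).
apply: measurableT_comp.
  by apply: continuous_measurable_fun; exact: sqrt_continuous.
by apply: measurable_funD; exact: measurable_funX.
Qed.

(** * Integration of complex functions *)

Lemma cintegrable_le d (T : measurableType d) (R : realType)
    (mu : {measure set T -> \bar R}) (f : T -> R[i]) (g : T -> R) :
  cmeasurable_fun f -> mu.-integrable setT (EFin \o g) ->
  (forall t, normc (f t) <= g t) -> cintegrable mu f.
Proof.
move=> [rf mf] ig fg; split; apply: le_integrable ig => //.
- exact/measurable_EFinP.
- move=> t _ /=; rewrite lee_fin (le_trans (normr_Re_le_normc _))//.
  by rewrite (le_trans (fg t))// ler_norm.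
- exact/measurable_EFinP.
- move=> t _ /=; rewrite lee_fin (le_trans (normr_Im_le_normc _))//.
  by rewrite (le_trans (fg t))// ler_norm.
Qed.

(** The real and the imaginary part are bounded separately, at the price of the
    factor [2]. *)
Lemma normc_cintegral_le d (T : measurableType d) (R : realType)
    (mu : {measure set T -> \bar R}) (f : T -> R[i]) (g : T -> R) :
  cintegrable mu f -> mu.-integrable setT (EFin \o g) ->
  (forall t, normc (f t) <= g t) ->
  normc (cintegral mu f) <= 2 * \int[mu]_t g t.
Proof.
move=> [rf mf] ig fg.
have int_le (h : T -> R) : mu.-integrable setT (EFin \o h) ->
    (forall t, `|h t| <= g t) -> `|\int[mu]_t h t| <= \int[mu]_t g t.
  move=> ih hg; apply: le_trans (le_normr_Rintegral measurableT ih) _.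
  by apply: le_Rintegral => //; exact: (integrable_norm ih).
rewrite (le_trans (normc_le_ReIm _))// mulr_natl mulr2n; apply: lerD.
  apply: int_le => // t.
  exact: le_trans (normr_Re_le_normc _) (fg t).
apply: int_le => // t.
exact: le_trans (normr_Im_le_normc _) (fg t).
Qed.

Lemma cintegrableB d (T : measurableType d) (R : realType)
    (mu : {measure set T -> \bar R}) (f g : T -> R[i]) :
  cintegrable mu f -> cintegrable mu g ->
  cintegrable mu (fun t => f t - g t).
Proof.
move=> [rf mf] [rg mg]; split.
  rewrite (_ : (fun _ => _) = (fun t => (complex.Re (f t))%:E) \-
    (fun t => (complex.Re (g t))%:E))%E; first exact: integrableB.
  by apply/funext => t /=; rewrite -EFinB; case: (f t); case: (g t).
rewrite (_ : (fun _ => _) = (fun t => (complex.Im (f t))%:E) \-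
  (fun t => (complex.Im (g t))%:E))%E; first exact: integrableB.
by apply/funext => t /=; rewrite -EFinB; case: (f t); case: (g t).
Qed.

Lemma cintegralB d (T : measurableType d) (R : realType)
    (mu : {measure set T -> \bar R}) (f g : T -> R[i]) :
  cintegrable mu f -> cintegrable mu g ->
  cintegral mu (fun t => f t - g t) = cintegral mu f - cintegral mu g.
Proof.
move=> [rf mf] [rg mg]; rewrite /cintegral.
have -> : (fun t => complex.Re (f t - g t)) =
    (fun t => complex.Re (f t) - complex.Re (g t)).
  by apply/funext => t; case: (f t); case: (g t).
have -> : (fun t => complex.Im (f t - g t)) =
    (fun t => complex.Im (f t) - complex.Im (g t)).
  by apply/funext => t; case: (f t); case: (g t).
by rewrite !RintegralB.
Qed.

Lemma cintegrableZl d (T : measurableType d) (R : realType)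
    (mu : {measure set T -> \bar R}) (c : R[i]) (f : T -> R[i]) :
  cintegrable mu f -> cintegrable mu (fun t => c * f t).
Proof.
move=> [rf mf]; split.
  rewrite (_ : (fun _ => _) =
    (fun t => (complex.Re c)%:E * (complex.Re (f t))%:E) \-
    (fun t => (complex.Im c)%:E * (complex.Im (f t))%:E))%E.
    by apply: integrableB => //; exact: integrableZl.
  by apply/funext => t; rewrite ReM.
rewrite (_ : (fun _ => _) =
  (fun t => (complex.Re c)%:E * (complex.Im (f t))%:E) \+
  (fun t => (complex.Im c)%:E * (complex.Re (f t))%:E))%E.
  by apply: integrableD => //; exact: integrableZl.
by apply/funext => t; rewrite ImM.
Qed.

Lemma cintegralZl d (T : measurableType d) (R : realType)
    (mu : {measure set T -> \bar R}) (c : R[i]) (f : T -> R[i]) :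
  cintegrable mu f ->
  cintegral mu (fun t => c * f t) = c * cintegral mu f.
Proof.
move=> [rf mf]; rewrite /cintegral.
under eq_Rintegral do rewrite ReM.
under [X in _ +i* X]eq_Rintegral do rewrite ImM.
have Z k (h : T -> R) : mu.-integrable setT (EFin \o h) ->
    mu.-integrable setT (EFin \o (fun t => k * h t)).
  by move=> ih; apply: (integrableZl measurableT k ih).
rewrite RintegralB ?RintegralD//; try exact: Z.
by rewrite !RintegralZl//; case: c.
Qed.

Lemma cintegral_sum d (T : measurableType d) (R : realType)
    (mu : {measure set T -> \bar R}) (f : nat -> T -> R[i]) n :
  (forall k, cintegrable mu (f k)) ->
  cintegrable mu (fun t => \sum_(k < n) f k t) /\
  cintegral mu (fun t => \sum_(k < n) f k t) =
    \sum_(k < n) cintegral mu (f k).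
Proof.
move=> fi; elim: n => [|n [ih1 ih2]].
  under eq_fun do rewrite big_ord0.
  split; first by split; exact: integrable0.
  by rewrite big_ord0 /cintegral /= !Rintegral_cst// !mul0r.
(* x + y is written x - (- 1) * y, so that subtraction and scaling suffice *)
have -> : (fun t => \sum_(k < n.+1) f k t) =
    (fun t => \sum_(k < n) f k t - (- 1) * f n t).
  by apply/funext => t; rewrite big_ord_recr/= mulN1r opprK.
have fni := cintegrableZl (- 1) (fi n).
split; first exact: cintegrableB.
by rewrite cintegralB// cintegralZl// ih2 big_ord_recr/= mulN1r opprK.
Qed.

(** * Laplace transforms with finite exponential moments *)

Lemma pow_fact_le_expR (R : realType) (x : R) n :
  0 <= x -> x ^+ n / n`!%:R <= expR x.
Proof.
case: n => [|n] x0; last by apply: le_trans (expR_ge1Dxn n x0); rewrite lerDr.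
by rewrite expr0 fact0 divr1 (le_trans _ (expR_ge1Dx x))// lerDl.
Qed.

Lemma cvg_geometric_error (R : realType) (u : nat -> (R[i] : numFieldType))
    (l : (R[i] : numFieldType)) (A q : R) :
  0 <= q < 1 -> (forall n, normc (l - u n) <= A * q ^+ n) ->
  u @ \oo --> l.
Proof.
move=> /andP[q0 q1] uA; apply/cvgrPdist_lt => e e0.
have eE : e = (complex.Re e)%:C.
  by move: e0; case: (e) => x y; rewrite ltcE/= => /andP[/eqP -> _].
have re0 : 0 < complex.Re e by move: e0; rewrite ltcE => /andP[].
have : (fun n => A * q ^+ n) @ \oo --> (0 : R).
  by apply: cvg_geometric; rewrite ger0_norm.
move=> /cvgrPdist_lt /(_ _ re0); apply: filterS => n.
rewrite sub0r normrN => An; rewrite eE norm_normc ltcR.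
exact: le_lt_trans (uA n) (le_lt_trans (ler_norm _) An).
Qed.

(** In the remainder [2 exp (2 |z w|) |z w|^n.+1 / n!], the power [q^n] is
    extracted from [|z|^n], and the rest is bounded through [|w| <= exp |w|],
    [|w|^n / n! <= exp |w|] and [|z w| <= |w|]. *)
Lemma cexp_remainder_scaled (R : realType) n (z w : R[i]) (q : R) :
  normc z <= q -> q <= 1 ->
  normc (cexp (z * w) - cexp_sum n.+1 (z * w)) <=
  2 * q ^+ n * expR (4 * normc w).
Proof.
move=> zq q1; set x := normc w; have x0 : 0 <= x := normc_ge0 w.
have q0 : 0 <= q := le_trans (normc_ge0 z) zq.
apply: le_trans (cexp_remainder _ _) _; rewrite -mulrA ler_pM2l//.
rewrite normcM -/x.
have zx : normc z * x <= q * x by rewrite ler_wpM2r.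
have zx0 : 0 <= normc z * x by rewrite mulr_ge0 ?normc_ge0.
have qx : q * x <= x by rewrite ler_piMl.
have -> : 4 * x = 2 * x + (x + x) by ring.
rewrite expRD [leRHS]mulrCA ler_pM ?expR_ge0 ?divr_ge0 ?exprn_ge0//.
  by rewrite ler_expR ler_pM2l// (le_trans zx).
have -> : (normc z * x) ^+ n.+1 / n`!%:R =
    normc z ^+ n * (normc z * x * (x ^+ n / n`!%:R)).
  by rewrite exprS !exprMn; ring.
have xn0 : 0 <= x ^+ n / n`!%:R by rewrite divr_ge0 ?exprn_ge0.
rewrite expRD; apply: ler_pM; rewrite ?exprn_ge0 ?normc_ge0//.
  exact: mulr_ge0.
  by rewrite lerXn2r ?nnegrE ?normc_ge0.
apply: ler_pM => //.
  rewrite (le_trans zx)// (le_trans qx)//.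
  by rewrite (le_trans _ (expR_ge1Dx x))// lerDr.
exact: pow_fact_le_expR.
Qed.

(** The series at [s0] converges on the disc of radius [1], with coefficients
    the integrals of [exp (s0 L) L^k / k!].  Every integrand met here, remainder
    included, is dominated by some [exp (m |L|)]. *)
Lemma laplace_transform_entire d (T : measurableType d) (R : realType)
    (mu : {measure set T -> \bar R}) (L : T -> R[i]) :
  cmeasurable_fun L ->
  (forall m : nat,
    mu.-integrable setT (fun t => (expR (m%:R * normc (L t)))%:E)) ->
  (forall s, cintegrable mu (fun t => cexp (s * L t))) /\
  entire (fun s => cintegral mu (fun t => cexp (s * L t))).
Proof.
move=> mL iL.
have mS s : cmeasurable_fun (fun t => s * L t).
  by apply: cmeasurable_funM mL; exact: cmeasurable_cst.
have dominated (s : R[i]) (k : nat) : exists m : nat,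
    forall t, expR (normc s * normc (L t)) * expR (k%:R * normc (L t)) <=
              expR (m%:R * normc (L t)).
  exists ((Num.trunc (normc s)).+1 + k)%N => t.
  rewrite -expRD ler_expR -mulrDl ler_wpM2r ?normc_ge0// natrD lerD2r.
  by rewrite ltW// truncnS_gt.
have iS s : cintegrable mu (fun t => cexp (s * L t)).
  have [m sm] := dominated s 0%N.
  apply: cintegrable_le (iL m) _; first exact: cmeasurable_cexp.
  move=> t; rewrite (le_trans (normc_cexp_le _))//.
  by rewrite (le_trans _ (sm t))// mul0r expR0 mulr1 normcM.
split => // s0.
pose F k t := cexp (s0 * L t) * (L t ^+ k / k`!%:R).
have iF k : cintegrable mu (F k).
  have [m sm] := dominated s0 1%N.
  apply: cintegrable_le (iL m) _.
    apply: cmeasurable_funM; first exact: cmeasurable_cexp.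
    apply: cmeasurable_funM; first exact: cmeasurable_funX.
    exact: cmeasurable_cst.
  move=> t; apply: le_trans (sm t).
  rewrite /F normcM (normcM (_ ^+ k)) normcX normcV.
  have -> : normc (k`!%:R : R[i]) = k`!%:R.
    by rewrite -(rmorph_nat (real_complex R)) normc_real ger0_norm.
  rewrite mul1r ler_pM ?normc_ge0 ?divr_ge0 ?exprn_ge0 ?normc_ge0//.
    by rewrite (le_trans (normc_cexp_le _))// normcM.
  exact: pow_fact_le_expR (normc_ge0 _).
have [m sm] := dominated s0 4%N.
exists 1, (fun k => cintegral mu (F k)); split=> // s.
rewrite norm_normc (ltcR _ 1) => s1.
(* the partial sum of n.+1 terms carries the remainder of order n *)
rewrite -cvg_shiftS /=.
apply: (@cvg_geometric_error _ _ _
  (4 * \int[mu]_t expR (m%:R * normc (L t))) (normc (s - s0))).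
  by rewrite normc_ge0.
move=> n.
have E (t : T) : cexp (s * L t) - \sum_(k < n.+1) (s - s0) ^+ k * F k t =
    cexp (s0 * L t) * (cexp ((s - s0) * L t) - cexp_sum n.+1 ((s - s0) * L t)).
  rewrite mulrBr -cexpD -mulrDl (addrC s0) subrK; congr (_ - _).
  rewrite /cexp_sum mulr_sumr; apply: eq_bigr => k _.
  by rewrite /F exprMn; ring.
have [sumi sumE] := cintegral_sum n.+1
  (fun k => cintegrableZl ((s - s0) ^+ k) (iF k)).
have -> : cintegral mu (fun t => cexp (s * L t)) -
    series (fun k => cintegral mu (F k) * (s - s0) ^+ k) n.+1 =
    cintegral mu (fun t => cexp (s * L t) -
      \sum_(k < n.+1) (s - s0) ^+ k * F k t).
  rewrite cintegralB// sumE /series/= big_mkord; congr (_ - _).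
  by apply: eq_bigr => k _; rewrite cintegralZl// mulrC.
set q := normc (s - s0).
have q0 : 0 <= q := normc_ge0 _.
have -> : 4 * \int[mu]_t expR (m%:R * normc (L t)) * q ^+ n =
    2 * \int[mu]_t (2 * q ^+ n * expR (m%:R * normc (L t))).
  by rewrite RintegralZl//; [ring|exact: iL].
apply: normc_cintegral_le; first exact: cintegrableB.
  exact: (integrableZl measurableT (2 * q ^+ n) (iL m)).
move=> t; rewrite E normcM.
have := @cexp_remainder_scaled _ n (s - s0) (L t) q (lexx _) (ltW s1).
move=> /(ler_pM (normc_ge0 _) (normc_ge0 _) (normc_cexp_le (s0 * L t))).
move=> /le_trans; apply; rewrite normcM mulrCA ler_wpM2l//.
by rewrite mulr_ge0// exprn_ge0.
Qed.

(** * Exponential moments of the logarithm *)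

(** The principal logarithm of [a + ix], for [0 < a]. *)
Definition half_plane_log (R : realType) (a x : R) : R[i] :=
  (ln (a ^+ 2 + x ^+ 2) / 2) +i* atan (x / a).

Lemma cpow_cexp_log (R : realType) (a x : R) (w : R[i]) :
  cpow (a +i* x) w = cexp (w * half_plane_log a x).
Proof.
rewrite /cpow /rcpow -cexpD; congr cexp.
have -> : half_plane_log a x =
    (ln (a ^+ 2 + x ^+ 2))%:C / 2 + 'i%C * (atan (x / a))%:C.
  rewrite -(rmorph_nat (real_complex R) 2) -fmorphV -rmorphM.
  by apply/eqP; rewrite eq_complex ReD ImD ReM ImM /=;
    apply/andP; split; apply/eqP; ring.
by rewrite /=; ring.
Qed.

Lemma cmeasurable_half_plane_log (R : realType) (a : R) :
  cmeasurable_fun (half_plane_log a).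
Proof.
split => /=.
  apply: measurable_funM => //.
  apply: measurableT_comp; first exact: measurable_ln.
  by apply: measurable_funD => //; exact: measurable_funX.
apply: measurableT_comp; last exact: measurable_funM.
by apply: continuous_measurable_fun => x; exact: continuous_atan.
Qed.

(** [exp (m |ln r|)] is [r^m] or [r^- m] according to the sign of [ln r]. *)
Lemma expR_norm_ln_le (R : realType) (r : R) m :
  0 < r -> expR (m%:R * `|ln r|) <= r ^+ m + r ^- m.
Proof.
move=> r0; rewrite expRM_natl.
have [l0|l0] := ger0P (ln r).
  by rewrite lnK ?posrE// lerDl invr_ge0 exprn_ge0// ltW.
by rewrite expRN lnK ?posrE// exprVn lerDr exprn_ge0// ltW.
Qed.

(** With [r = a^2 + x^2], the bound [|log (a + ix)| <= pi + |ln r|] reduces the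
    claim to [r^m + r^- m], where [r^- m <= a^(- 2 m)] and [r] is at most twice
    the larger of [a^2] and [x^2]. *)
Lemma expR_half_plane_log_le (R : realType) (a x : R) m :
  0 < a ->
  expR (m%:R * normc (half_plane_log a x)) <=
  expR (m%:R * pi) *
    (((2 * a ^+ 2) ^+ m + a ^- 2 ^+ m) + 2 ^+ m * `|x| ^+ (2 * m)).
Proof.
move=> a0; set r := a ^+ 2 + x ^+ 2.
have ar : a ^+ 2 <= r by rewrite lerDl sqr_ge0.
have r0 : 0 < r by rewrite (lt_le_trans _ ar)// exprn_gt0.
have logle : normc (half_plane_log a x) <= pi + `|ln r|.
  rewrite (le_trans (normc_le_ReIm _))//= addrC -/r lerD//.
    rewrite ler_norml; have := atan_ltpi2 (x / a); have := atan_gtNpi2 (x / a).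
    by have := pi_ge0 R; lra.
  by rewrite normrM ler_piMr// ger0_norm// invf_le1// ler1n.
rewrite (@le_trans _ _ (expR (m%:R * (pi + `|ln r|))))//.
  by rewrite ler_expR ler_wpM2l.
rewrite mulrDr expRD ler_wpM2l ?expR_ge0//.
rewrite (le_trans (expR_norm_ln_le m r0))//.
have rVa : r ^- m <= a ^- 2 ^+ m.
  rewrite -exprVn lerXn2r ?nnegrE ?invr_ge0 ?sqr_ge0 ?(ltW r0)//.
  by rewrite lef_pV2 ?posrE ?exprn_gt0.
have x2m : (2 * x ^+ 2) ^+ m = 2 ^+ m * `|x| ^+ (2 * m).
  by rewrite exprMn exprM real_normK ?num_real.
have rm : r ^+ m <= (2 * a ^+ 2) ^+ m + (2 * x ^+ 2) ^+ m.
  have a2 : 0 <= a ^+ 2 by rewrite sqr_ge0.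
  have x2 : 0 <= x ^+ 2 by rewrite sqr_ge0.
  have [xa|xa] := leP (x ^+ 2) (a ^+ 2).
    rewrite (@le_trans _ _ ((2 * a ^+ 2) ^+ m))//.
      by rewrite lerXn2r ?nnegrE /r//; lra.
    by rewrite lerDl exprn_ge0//; lra.
  rewrite (@le_trans _ _ ((2 * x ^+ 2) ^+ m))//.
    by rewrite lerXn2r ?nnegrE /r//; lra.
  by rewrite lerDr exprn_ge0//; lra.
by rewrite -x2m addrAC lerD.
Qed.

(** * Integrals against the distribution function *)

(** Lebesgue-Stieltjes measures live on [measurableTypeR R], which has the same
    measurable sets as [R] but another display; this is [X] with that
    codomain. *)
Definition borel_RV d (T : measurableType d) (R : realType)
    (P : probability T R) (X : {RV P >-> R}) : {RV P >-> measurableTypeR R} :=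
  MeasurableFun.Pack (MeasurableFun.Class (isMeasurableFun.Build d _ T
    (measurableTypeR R) X (measurable_funPT X))).

(** Both measures give [F b - F a] to the interval [ ]a, b] ], where [F] is the
    distribution function, and these intervals determine a Lebesgue-Stieltjes
    measure. *)
Lemma lebesgue_stieltjes_dist_fun d (T : measurableType d) (R : realType)
    (P : probability T R) (X : {RV P >-> R}) (A : set (measurableTypeR R)) :
  measurable A ->
  lebesgue_stieltjes_measure (dist_fun X) A = distribution P (borel_RV X) A.
Proof.
apply: lebesgue_stieltjes_measure_unique => I [[a b]]/= _ <-.
rewrite /lebesgue_stieltjes_measure /measure_extension/=.
rewrite measurable_mu_extE/=; last exact: is_ocitv.
have [ab | ba] := leP a b; last first.
  by rewrite set_itv_ge ?wlength0 ?measure0// bnd_simp -leNgt ltW.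
rewrite wlength_itv_bnd// EFinB !fineK ?fin_num_measure//.
have -> : `]a, b]%classic = `]-oo, b] `\` `]-oo, a].
  by rewrite -[RHS]setCK setCD setCitvl setUC -[LHS]setCK setCitv.
rewrite measureD ?setIidr//; first exact: subset_itvl.
by rewrite -ge0_fin_numE// fin_num_measure.
Qed.

Lemma integral_dist_fun d (T : measurableType d) (R : realType)
    (P : probability T R) (X : {RV P >-> R}) (f : R -> R) :
  measurable_fun setT f ->
  P.-integrable setT (fun t => (f (X t))%:E) ->
  (lebesgue_stieltjes_measure (dist_fun X)).-integrable setT
    (fun x => (f x)%:E) /\
  \int[P]_t f (X t) =
  \int[lebesgue_stieltjes_measure (dist_fun X)]_x f x.
Proof.
move=> mf iX.
have mfE : measurable_fun [set: measurableTypeR R] (EFin \o f).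
  exact/measurable_EFinP.
have eqI (g : R -> \bar R) :
    (\int[lebesgue_stieltjes_measure (dist_fun X)]_x g x =
     \int[distribution P (borel_RV X)]_x g x)%E.
  by apply: eq_measure_integral => A mA _; exact: lebesgue_stieltjes_dist_fun.
split.
  have := integrable_pushforward (measurable_funPT (borel_RV X)) mfE iX
    measurableT.
  by move=> /integrableP[_ fin]; apply/integrableP; split => //; rewrite eqI.
rewrite /Rintegral eqI; congr fine.
by rewrite (integral_distribution (X := borel_RV X) mfE iX).
Qed.

(** * The Hurwitz zeta function of a random variable *)

Lemma expR_half_plane_log_integrable d (T : measurableType d) (R : realType)
    (P : probability T R) (X : {RV P >-> R}) (a : R) (m : nat) :
  0 < a ->
  (forall n : nat, (1 <= n)%N ->
    ('E_P[(fun t => `|X t| ^+ n)%R] < +oo)%E) ->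
  P.-integrable setT
    (fun t => (expR (m%:R * normc (half_plane_log a (X t))))%:E).
Proof.
move=> a0 hX.
have normX_int n : P.-integrable setT (fun t => (`|X t| ^+ n)%:E).
  case: n => [|n].
    under eq_fun do rewrite expr0.
    exact: finite_measure_integrable_cst.
  apply/integrableP; split.
    apply/measurable_EFinP/measurable_funX; apply: measurableT_comp => //.
  move: (hX n.+1 isT); rewrite unlock; congr (_ < _)%E.
  by apply: eq_integral => t _; rewrite gee0_abs// lee_fin exprn_ge0.
have mexp : measurable_fun setT
    (fun t => expR (m%:R * normc (half_plane_log a (X t)))).
  apply: measurableT_comp; first exact: measurable_expR.
  apply: measurable_funM => //; apply: measurable_normc.
  exact: cmeasurable_comp (cmeasurable_half_plane_log a) (measurable_funPT X).
pose K := (2 * a ^+ 2) ^+ m + a ^- 2 ^+ m.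
apply: (@le_integrable _ _ _ P setT measurableT _
  (fun t => (expR (m%:R * pi) * (K + 2 ^+ m * `|X t| ^+ (2 * m)))%:E)).
- exact/measurable_EFinP.
- move=> t _; rewrite /= lee_fin ger0_norm ?expR_ge0//.
  by rewrite (le_trans _ (ler_norm _))// expR_half_plane_log_le.
- under eq_fun do rewrite EFinM EFinD EFinM.
  apply: integrableZl => //; apply: integrableD => //.
    exact: finite_measure_integrable_cst.
  exact: integrableZl.
Qed.

Theorem lemma2p1 (d : measure_display) (T : measurableType d) (R : realType)
    (P : probability T R) (X : {RV P >-> R})
    (hX : forall n : nat, (1 <= n)%N ->
      ('E_P[(fun t => `|X t| ^+ n)%R] < +oo)%E)
    (a : R) (ha : 0 < a) :
  (forall s : R[i],
    [/\ cintegrable P (fun t => cpow (a +i* X t) (- s)),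
        cintegrable (lebesgue_stieltjes_measure (dist_fun X))
          (fun x : R => cpow (a +i* x) (- s))
      & hurwitz_zeta X s a =
        cintegral (lebesgue_stieltjes_measure (dist_fun X))
          (fun x : R => cpow (a +i* x) (- s))]) /\
  entire (fun s : R[i] => hurwitz_zeta X s a).
Proof.
have cpowE (x : R) (s : R[i]) :
    cpow (a +i* x) (- s) = cexp (s * - half_plane_log a x).
  by rewrite cpow_cexp_log mulNr mulrN.
have mlog : cmeasurable_fun (fun x => - half_plane_log a x).
  under eq_fun do rewrite -sub0r.
  apply: cmeasurable_funB; first exact: cmeasurable_cst.
  exact: cmeasurable_half_plane_log.
have mlogX : cmeasurable_fun (fun t => - half_plane_log a (X t)).
  exact: cmeasurable_comp mlog (measurable_funPT X).
have ilogX (m : nat) : P.-integrable setT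
    (fun t => (expR (m%:R * normc (- half_plane_log a (X t))))%:E).
  under eq_fun do rewrite normcN.
  exact: expR_half_plane_log_integrable.
have [iexp entire_exp] := laplace_transform_entire mlogX ilogX.
have zetaE : (fun s => hurwitz_zeta X s a) =
    (fun s => cintegral P (fun t => cexp (s * - half_plane_log a (X t)))).
  by apply/funext => s; congr cintegral; apply/funext => t; exact: cpowE.
split; last by rewrite zetaE.
move=> s; rewrite [hurwitz_zeta X s a](congr1 (@^~ s) zetaE).
under eq_fun do rewrite cpowE.
under [fun x : R => _]eq_fun do rewrite cpowE.
have [mr mi] : cmeasurable_fun (fun x => cexp (s * - half_plane_log a x)).
  apply: cmeasurable_cexp; apply: cmeasurable_funM mlog.
  exact: cmeasurable_cst.
have [ir ii] := iexp s.
have [rF rE] := integral_dist_fun mr ir.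
have [iF iE] := integral_dist_fun mi ii.
by split; [exact: iexp|split|rewrite /cintegral rE iE].
Qed.
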